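(* Let $G$ be a subdivision of a simple $3$-connected plane graph $R$, and let $S = S(G)$ be the subdivision multigraph of $G$. Then $\chi_c(G) \leq \chi'(S) + \chi_c(R)$. Moreover, the bound is tight: there exist such graphs $G$ for which equality holds.
   Context: Plane graphs may have multiple edges but no loops; a simple graph has no multiple edges. A subdivision of a graph is obtained by repeatedly replacing an edge $uv$ by a path $u,w,v$ through a new vertex $w$; the faces of $G$ are in natural one-to-one correspondence with the faces of $R$, and the vertices of $G$ of degree at least $3$ are exactly the vertices of $R$. A cyclic coloring of a plane graph is a vertex coloring in which any two distinct vertices incident with a common face receive distinct colors; $\chi_c$ denotes the minimum number of colors in a cyclic coloring. The subdivision multigraph $S(G)$ is the multigraph whose vertex set is the face set $F(G)$ of $G$ and whose edge set is the set $V_2(G)$ of vertices of degree $2$ of $G$, where the edge $v\in V_2(G)$ joins the vertices $f_a, f_b$ of $S$ if and only if $v$ is incident in $G$ with both faces $f_a$ and $f_b$. $\chi'(S)$ denotes the chromatic index (minimum number of colors in a proper edge coloring) of $S$. *)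

(* Defs.v *)
From HB Require Import structures.
From mathcomp Require Import all_boot all_fingroup.
Set Implicit Arguments.
Unset Strict Implicit.
Unset Printing Implicit Defensive.
Local Open Scope nat_scope.

(* Plane graphs are encoded as combinatorial maps of genus 0: a [cmap] is a
   graph cellularly embedded in oriented surfaces (one per component), without
   isolated vertices; connected plane graphs with at least one edge, up to
   homeomorphism of the sphere, are the connected planar [cmap]s.  A dart
   is an edge with a direction; [opp] reverses it and [rot] rotates it to the
   next dart with the same origin.  Vertices, edges and faces are the orbits of
   [rot], [opp] and [face_perm]. *)
Record cmap := Cmap {
  dart : finType;
  opp : {perm dart};
  rot : {perm dart};
  oppK : involutive opp;
  opp_neq : forall x, opp x != x
}.

(* [face_perm G x = rot G (opp G x)] is the dart after [x] on a face walk. *)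
Definition face_perm (G : cmap) : {perm dart G} := (opp G * rot G)%g.

Definition vertex (G : cmap) : finType := {v : {set dart G} | v \in porbits (rot G)}.
Definition face (G : cmap) : finType := {f : {set dart G} | f \in porbits (face_perm G)}.

Definition degree (G : cmap) (v : vertex G) : nat := #|val v|.

(* The corner at the origin of [x] preceding [x] in the rotation belongs to the
   face of [x], so common darts of a vertex and a face are their incidences. *)
Definition incident (G : cmap) (v : vertex G) (f : face G) : bool :=
  [exists x, (x \in val v) && (x \in val f)].

Definition adjacent (G : cmap) (u v : vertex G) : bool :=
  [exists x, (x \in val u) && (opp G x \in val v)].

Definition dart_link (G : cmap) : rel (dart G) :=
  [rel x y | (y == rot G x) || (y == opp G x)].

(* Euler's formula V - E + F = 2c, c being the number of components: the
   surface of every component is a sphere. *)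
Definition planar (G : cmap) : Prop :=
  #|porbits (rot G)| + #|porbits (face_perm G)|
  = #|porbits (opp G)| + 2 * n_comp (@dart_link G) predT.

Definition loopless (G : cmap) : Prop :=
  forall x : dart G, opp G x \notin porbit (rot G) x.

Definition no_multiple_edges (G : cmap) : Prop :=
  forall x y : dart G,
    y \in porbit (rot G) x -> opp G y \in porbit (rot G) (opp G x) -> y = x.

Definition simple_graph (G : cmap) : Prop := loopless G /\ no_multiple_edges G.

Definition k_connected (k : nat) (G : cmap) : Prop :=
  k < #|vertex G| /\
  forall A : {set vertex G}, #|A| < k ->
    forall u v : vertex G, u \notin A -> v \notin A ->
      connect [rel a b | [&& a \notin A, b \notin A & adjacent a b]] u v.

Definition cmap_iso (G H : cmap) : Prop :=
  exists h : dart G -> dart H,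
    [/\ bijective h,
        forall x, h (opp G x) = opp H (h x)
      & forall x, h (rot G x) = rot H (h x)].

(* Subdividing the edge {x, opp x}: the new vertex w carries the darts
   [inr true] (opposite to [x]) and [inr false] (opposite to [opp x]). *)
Section Subdivide.
Variables (G : cmap) (x : dart G).

Definition sub_opp_fun (z : dart G + bool) : dart G + bool :=
  match z with
  | inl y => if y == x then inr true
             else if y == opp G x then inr false
             else inl (opp G y)
  | inr b => if b then inl x else inl (opp G x)
  end.

Definition sub_rot_fun (z : dart G + bool) : dart G + bool :=
  match z with
  | inl y => inl (rot G y)
  | inr b => inr (~~ b)
  end.

Lemma sub_opp_funK : involutive sub_opp_fun.
Proof.
case=> [y|[]] /=; last 2 first.
- by rewrite eqxx.
- by rewrite (negPf (opp_neq x)) eqxx.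
case: (y =P x) => [->|nyx] //=; case: (y =P opp G x) => [->|nyo] //=.
rewrite -{1}[x](@oppK G) !(inj_eq perm_inj).
by case: (y =P opp G x) => // _; case: (y =P x) => // _; rewrite oppK.
Qed.

Lemma sub_rot_fun_inj : injective sub_rot_fun.
Proof. by case=> [y|b] [y'|b'] //= [] => [/perm_inj ->|/negb_inj ->]. Qed.

Definition sub_opp := perm (inv_inj sub_opp_funK).
Definition sub_rot := perm sub_rot_fun_inj.

Lemma sub_oppK : involutive sub_opp.
Proof. by move=> z; rewrite !permE sub_opp_funK. Qed.

Lemma sub_opp_neq z : sub_opp z != z.
Proof.
rewrite permE; case: z => [y|[]] //=.
by do 2!case: ifP => // _; apply/eqP => -[/eqP]; rewrite (negPf (opp_neq y)).
Qed.

Definition subdivide : cmap := Cmap sub_rot sub_oppK sub_opp_neq.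
End Subdivide.

Inductive subdivision (R : cmap) : cmap -> Prop :=
| subdivision_iso G : cmap_iso R G -> subdivision R G
| subdivision_step G (x : dart G) H :
    subdivision R G -> cmap_iso (subdivide x) H -> subdivision R H.

(* [conflict] is only consulted on distinct elements. *)
Definition colorable (T : finType) (conflict : rel T) (k : nat) : bool :=
  [exists c : {ffun T -> 'I_k},
    [forall x, forall y, (x != y) && conflict x y ==> (c x != c y)]].

Lemma colorable_ex (T : finType) (conflict : rel T) :
  exists k, colorable conflict k.
Proof.
exists #|T|; apply/existsP; exists [ffun x => enum_rank x].
apply/forallP => x; apply/forallP => y; apply/implyP => /andP[nxy _].
by rewrite !ffunE (inj_eq enum_rank_inj).
Qed.

Definition min_colors (T : finType) (conflict : rel T) : nat :=
  ex_minn (colorable_ex conflict).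

Definition cofacial (G : cmap) : rel (vertex G) :=
  [rel u v | [exists f : face G, incident u f && incident v f]].

Definition cyclic_chromatic_number (G : cmap) : nat := min_colors (@cofacial G).

Record multigraph := Multigraph {
  mvertex : finType;
  medge : finType;
  ends : medge -> {set mvertex};
  ends_card : forall e, 0 < #|ends e| <= 2
}.

Definition share_end (M : multigraph) : rel (medge M) :=
  [rel a b | ends a :&: ends b != set0].

Definition chromatic_index (M : multigraph) : nat := min_colors (@share_end M).

Definition vertex2 (G : cmap) : finType := {v : vertex G | degree v == 2}.

Section SubdivisionMultigraph.
Variable G : cmap.

Definition S_ends (v : vertex2 G) : {set face G} :=
  [set f | incident (val v) f].

Definition face_of (x : dart G) : face G :=
  Sub (porbit (face_perm G) x) (imset_f _ (isT : x \in predT)).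

Lemma S_endsE v : S_ends v = face_of @: val (val v).
Proof.
apply/setP => f; rewrite inE; apply/existsP/imsetP => [[x /andP[xv xf]]|[x xv ->]].
  exists x => //; apply: val_inj => /=.
  case: f xf => f /= /imsetP[y _ ->] xf; apply/eqP.
  by rewrite eq_porbit_mem porbit_sym.
by exists x; rewrite xv /= porbit_id.
Qed.

Lemma S_ends_card v : 0 < #|S_ends v| <= 2.
Proof.
have d2 : #|val (val v)| = 2 by exact/eqP/(valP v).
rewrite S_endsE; apply/andP; split.
  by rewrite card_gt0 imset_eq0 -card_gt0 d2.
by apply: leq_trans (leq_imset_card _ _) _; rewrite d2.
Qed.

Definition subdivision_multigraph : multigraph := Multigraph S_ends_card.
End SubdivisionMultigraph.

(* Main.v *)
(** Subdividing edges never merges or splits faces, so the darts of [R] embed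
    into those of [G] compatibly with the rotation and with membership in a
    common face, and every dart of [G] outside the image sits at a vertex of
    degree 2.  An edge coloring of [S] on the vertices of degree 2 and a cyclic
    coloring of [R], with disjoint palettes, on the other ones therefore give a
    cyclic coloring of [G].  Equality holds when [R] is K4 and [G] arises from
    it by subdividing a single edge: the two faces at that edge cover all five
    vertices of [G], which are pairwise cofacial, so 5 = 1 + 4 colors are
    needed. *)
Require Import Defs.
From mathcomp Require Import all_boot all_fingroup.
(* [seq.rot] would otherwise shadow the rotation of a [cmap]. *)
Import Defs.
Local Open Scope nat_scope.

(** * Colorings *)

Lemma colorableP (T : finType) (e : rel T) (k : nat) :
  reflect (exists c : T -> 'I_k, forall x y, x != y -> e x y -> c x != c y)
          (colorable e k).
Proof.
apply: (iffP existsP) => [[c /forallP H]|[c H]].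
  exists c => x y nxy exy; move/forallP: (H x) => /(_ y) /implyP.
  by apply; rewrite nxy.
exists (finfun c); apply/forallP => x; apply/forallP => y.
by apply/implyP => /andP[nxy exy]; rewrite !ffunE H.
Qed.

Lemma colorable_min_colors (T : finType) (e : rel T) :
  colorable e (min_colors e).
Proof. by rewrite /min_colors; case: ex_minnP. Qed.

Lemma min_colors_le (T : finType) (e : rel T) (k : nat) :
  colorable e k -> min_colors e <= k.
Proof. by rewrite /min_colors; case: ex_minnP => m _; apply. Qed.

Lemma min_colors_le_card (T : finType) (e : rel T) : min_colors e <= #|T|.
Proof.
apply/min_colors_le/colorableP; exists enum_rank => x y nxy _.
by rewrite (inj_eq enum_rank_inj).
Qed.

Lemma card_le_min_colors (T : finType) (e : rel T) :
  (forall x y, e x y) -> #|T| <= min_colors e.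
Proof.
move=> eT; have /colorableP[c cP] := colorable_min_colors T e.
rewrite -[X in _ <= X]card_ord; apply: (@leq_card _ _ c) => x y cxy.
by apply/eqP; case: eqVneq => // /cP /(_ (eT x y)); rewrite cxy eqxx.
Qed.

(** * Orbits *)

(** The map [p] need not commute with the permutations: one step of [s] may become any number of
    steps of [s']. This leaves room for maps that collapse new darts onto old ones. *)
Lemma porbit_stable {T T' : finType} {s : {perm T}} {s' : {perm T'}}
    (p : T -> T') :
  (forall z, p (s z) \in porbit s' (p z)) ->
  forall x y, y \in porbit s x -> p y \in porbit s' (p x).
Proof.
move=> ps x y /porbitP[n ->]; rewrite permX.
elim: n => [|n IHn] /=; first exact: porbit_id.
by move: (ps (iter n s x)); rewrite -!eq_porbit_mem in IHn * => /eqP ->.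
Qed.

Lemma porbit_morph {T T' : finType} {s : {perm T}} {s' : {perm T'}}
    (i : T -> T') :
  (forall x, i (s x) = s' (i x)) ->
  forall x, porbit s' (i x) = i @: porbit s x.
Proof.
move=> i_s x; apply/setP => y; apply/idP/imsetP => [/porbitP[n ->]|[z xz ->]].
  exists ((s ^+ n)%g x); first exact: mem_porbit.
  by rewrite !permX; elim: n => //= n ->.
apply: porbit_stable xz => z'; rewrite i_s.
by have := mem_porbit s' 1 (i z'); rewrite expg1.
Qed.

(** An invariant label separates orbits, and the last hypothesis makes it complete. Here [m] bounds
    the orbit lengths, so on concrete maps everything reduces to finite computation. *)
Lemma porbit_label {T : finType} {L : eqType} {s : {perm T}} {f : T -> T}
    {lab : T -> L} (m : nat) :
  s =1 f -> (forall x, lab (f x) == lab x) ->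
  (forall x y, lab x == lab y -> has (fun k => iter k f x == y) (iota 0 m)) ->
  forall x y, (y \in porbit s x) = (lab x == lab y).
Proof.
move=> sf labf labC x y; apply/porbitP/idP => [[n ->]|/labC/hasP[k _ /eqP <-]].
  rewrite permX (eq_iter sf).
  by elim: n => //= n /eqP ->; rewrite (eqP (labf _)).
by exists k; rewrite permX (eq_iter sf).
Qed.

Lemma card_porbits_label {T L : finType} {s : {perm T}} {lab : T -> L}
    (g : L -> T) :
  cancel g lab -> (forall x y, (y \in porbit s x) = (lab x == lab y)) ->
  #|porbits s| = #|L|.
Proof.
move=> gK labP.
have -> : porbits s = [set porbit s (g l) | l in L].
  apply/setP => A; apply/imsetP/imsetP => [[x _ ->]|[l _ ->]]; last by exists (g l).
  by exists (lab x) => //; apply/eqP; rewrite eq_porbit_mem labP gK.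
rewrite card_imset // => l l' /eqP; rewrite eq_porbit_mem labP !gK.
by move/eqP.
Qed.

(** * Vertices and faces of combinatorial maps *)

Definition vertex_of {G : cmap} (x : dart G) : vertex G :=
  Sub (porbit (rot G) x) (imset_f _ (isT : x \in predT)).

Lemma vertex_ofP {G : cmap} (v : vertex G) : exists x, v = vertex_of x.
Proof.
case: v => v vP; have /imsetP[x _ vx] := vP; exists x.
exact: val_inj.
Qed.

Lemma mem_vertex {G : cmap} {v : vertex G} {x} : x \in val v -> v = vertex_of x.
Proof.
have [y ->] := vertex_ofP v => /= xy; apply: val_inj => /=.
by apply/eqP; rewrite eq_porbit_mem porbit_sym.
Qed.

Lemma vertex_of_eq {G : cmap} (x y : dart G) :
  (vertex_of x == vertex_of y) = (y \in porbit (rot G) x).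
Proof. by rewrite -val_eqE /= eq_porbit_mem porbit_sym. Qed.

Lemma card_vertex (G : cmap) : #|vertex G| = #|porbits (rot G)|.
Proof. by rewrite card_sig; apply: eq_card. Qed.

Lemma adjacent_vertex_of {G : cmap} (x : dart G) :
  adjacent (vertex_of x) (vertex_of (opp G x)).
Proof. by apply/existsP; exists x; rewrite /= !porbit_id. Qed.

Lemma face_incident {G : cmap} (u v : vertex G) (f : face G) :
  incident u f -> incident v f ->
  exists x y, [/\ x \in val u, y \in val v & y \in porbit (face_perm G) x].
Proof.
move=> /existsP[x /andP[xu xf]] /existsP[y /andP[yv yf]]; exists x, y.
split=> //; case: f xf yf => f /= /imsetP[z _ ->] xf yf.
by move: xf; rewrite -eq_porbit_mem => /eqP ->.
Qed.

Lemma cofacial_vertex_of {G : cmap} {x y : dart G} :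
  y \in porbit (face_perm G) x -> @cofacial G (vertex_of x) (vertex_of y).
Proof.
move=> xy; apply/existsP; exists (face_of x).
apply/andP; split; apply/existsP; [exists x | exists y].
  by rewrite /= !porbit_id.
by rewrite /= porbit_id.
Qed.

(** * Subdivisions *)

(** Commutation with [opp] would fail on a subdivided edge, whose darts get new opposites; the
    clause on faces takes its place. *)
Definition dart_embedding (R G : cmap) (i : dart R -> dart G) : Prop :=
  [/\ injective i, forall x, i (rot R x) = rot G (i x),
      forall y, (exists x, y = i x) \/ #|porbit (rot G) y| = 2 &
      forall x y, i y \in porbit (face_perm G) (i x) ->
        y \in porbit (face_perm R) x].

Lemma dart_embedding_iso R G H i :
  dart_embedding R G i -> cmap_iso G H -> exists j, dart_embedding R H j.
Proof.
case=> inj_i i_rot i_cover i_face [h [h_bij h_opp h_rot]].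
have inj_h := bij_inj h_bij; exists (h \o i); split=> /=.
- exact: inj_comp.
- by move=> x; rewrite i_rot h_rot.
- move=> y; have [h' _ hK] := h_bij; rewrite -(hK y).
  case: (i_cover (h' y)) => [[x ->]|d2]; [by left; exists x | right].
  by rewrite (porbit_morph h h_rot) card_imset.
- move=> x y; rewrite (@porbit_morph _ _ (face_perm G)).
    by rewrite mem_imset //; apply: i_face.
  by move=> z; rewrite !permM h_rot h_opp.
Qed.

(** * Subdivision of a single edge *)

Section SubdivideTheory.
Variables (G : cmap) (x : dart G).

Lemma card_porbit_sub_rot_inr b : #|porbit (rot (@subdivide G x)) (inr b)| = 2.
Proof.
pose s := perm (inv_inj negbK).
rewrite (@porbit_morph _ _ s _ inr); last by move=> z; rewrite !permE.
rewrite card_imset; last by move=> ? ? [].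
have -> : porbit s b = [set: bool]; last by rewrite cardsT card_bool.
apply/setP => c; rewrite in_setT; have [->|ncb] := eqVneq c b.
  exact: porbit_id.
have -> : c = (s ^+ 1)%g b by rewrite expg1 permE; case: b c ncb => [] [].
exact: mem_porbit.
Qed.

Lemma porbit_sub_rot_inl y :
  porbit (rot (@subdivide G x)) (inl y) = inl @: porbit (rot G) y.
Proof. by apply: porbit_morph => z; rewrite permE. Qed.

(* The dart of [G] whose face contains the given dart of the subdivision. *)
Definition unsubdivide (z : dart (@subdivide G x)) : dart G :=
  match z with
  | inl y => y
  | inr b => if b then opp G x else x
  end.

(** Walking from [inl x] to [inr false], or from [inl (opp G x)] to [inr true], is collapsed to
    standing still; every other step is a face step of [G]. *)
Lemma unsubdivide_face_perm z :
  unsubdivide (face_perm (@subdivide G x) z)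
    \in porbit (face_perm G) (unsubdivide z).
Proof.
have step y : rot G (opp G y) \in porbit (face_perm G) y.
  by have := mem_porbit (face_perm G) 1 y; rewrite expg1 permM.
rewrite permM !permE; case: z => [y|[]] /=.
- case: eqP => [->|_]; first exact: porbit_id.
  by case: eqP => [->|_] /=; [exact: porbit_id | exact: step].
- by rewrite -{1}(oppK x); apply: step.
- exact: step.
Qed.

Lemma dart_embedding_subdivide : dart_embedding G (@subdivide G x) inl.
Proof.
split=> [? ? []|y|[y|b]|y z] //.
- by rewrite permE.
- by left; exists y.
- by right; apply: card_porbit_sub_rot_inr.
(* [unsubdivide] is a left inverse of [inl], so it carries a common face back to [G]. *)
- exact: (porbit_stable unsubdivide unsubdivide_face_perm).
Qed.

End SubdivideTheory.

Lemma dart_embedding_comp R G H i j :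
  dart_embedding R G i -> dart_embedding G H j -> dart_embedding R H (j \o i).
Proof.
case=> inj_i i_rot i_cover i_face [inj_j j_rot j_cover j_face]; split=> /=.
- exact: inj_comp.
- by move=> x; rewrite i_rot j_rot.
- move=> y; case: (j_cover y) => [[z ->]|]; last by right.
  case: (i_cover z) => [[x ->]|d2]; [by left; exists x | right].
  by rewrite (porbit_morph j j_rot) card_imset.
- by move=> x y /j_face/i_face.
Qed.

Lemma dart_embedding_id G : dart_embedding G G id.
Proof. by split=> // y; left; exists y. Qed.

Lemma subdivision_dart_embedding R G :
  subdivision R G -> exists i, dart_embedding R G i.
Proof.
elim=> {G} [G|G x H _ [i iP]]; first exact: dart_embedding_iso (dart_embedding_id R).
apply: dart_embedding_iso.
exact: dart_embedding_comp iP (dart_embedding_subdivide G x).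
Qed.

Lemma subdivision_subdivide R (x : dart R) : subdivision R (@subdivide R x).
Proof.
have id_iso G : cmap_iso G G by exists id; split=> //; exists id.
exact: subdivision_step (subdivision_iso (id_iso R)) (id_iso _).
Qed.

(** * The upper bound, by merging two colorings *)

Lemma cyclic_chromatic_number_embedding R G i :
  dart_embedding R G i ->
  cyclic_chromatic_number G
  <= chromatic_index (subdivision_multigraph G) + cyclic_chromatic_number R.
Proof.
case=> inj_i i_rot i_cover i_face; apply/min_colors_le/colorableP.
have /colorableP[ce ceP] :=
  colorable_min_colors _ (@share_end (subdivision_multigraph G)).
have /colorableP[cR cRP] := colorable_min_colors _ (@cofacial R).
rewrite -/(chromatic_index _) -/(cyclic_chromatic_number _) in ce ceP cR cRP *.
set a := chromatic_index _ in ce ceP *.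
set b := cyclic_chromatic_number _ in cR cRP *.
(* Admissible colors: the first [a] serve the vertices of degree 2, the last [b] all others, through
   a dart of [R] embedded at [v]. *)
pose P v (c : 'I_(a + b)) :=
  (exists2 w : vertex2 G, val w = v & c = lshift b (ce w)) \/
  (exists x, [/\ i x \in val v, degree v != 2
                 & c = rshift a (cR (vertex_of x))]).
have /fin_all_exists[c cP] : forall v, exists c, P v c.
  move=> v; case: (boolP (degree v == 2)) => d2.
    by exists (lshift b (ce (Sub v d2))); left; exists (Sub v d2).
  have [y vy] := vertex_ofP v; case: (i_cover y) => [[x yx]|y2]; last first.
    by move: d2; rewrite /degree vy /= y2.
  exists (rshift a (cR (vertex_of x))); right; exists x.
  by rewrite d2 vy yx /= porbit_id.
exists c => u v nuv /existsP[f /andP[uf vf]].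
case: (cP u) => [[w wu ->]|[x [xu u2 ->]]];
  case: (cP v) => [[w' wv ->]|[x' [xv v2 ->]]].
- rewrite eq_lshift; apply: ceP.
    by apply: contraNneq nuv => ww; rewrite -wu -wv ww.
  by apply/set0Pn; exists f; rewrite !inE wu wv uf.
- by rewrite eq_lrshift.
- by rewrite eq_rlshift.
rewrite eq_rshift.
(* At a vertex of degree other than 2 all darts come from [R], and from a single vertex of [R]. *)
have deg_preim (w : vertex G) y z : degree w != 2 -> i z \in val w ->
    y \in val w -> exists2 t, y = i t & vertex_of t = vertex_of z.
  move=> w2 zw yw; case: (i_cover y) => [[t yt]|y2]; last first.
    by move: w2; rewrite (mem_vertex yw) /degree /= y2.
  exists t => //; apply/eqP; rewrite eq_sym vertex_of_eq.
  move: yw; rewrite (mem_vertex zw) /= (porbit_morph i i_rot) yt.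
  by rewrite mem_imset.
(* The darts [x] and [x'] that fixed the colors need not lie on the common face; they are exchanged
   for darts at the same vertices that do. *)
have [y [z [yu zv yz]]] := face_incident _ _ _ uf vf.
have [t yt <-] := deg_preim _ _ _ u2 xu yu.
have [t' zt <-] := deg_preim _ _ _ v2 xv zv.
apply: cRP; last by apply/cofacial_vertex_of/i_face; rewrite -yt -zt.
apply: contraNneq nuv => /eqP; rewrite vertex_of_eq => tt.
rewrite (mem_vertex yu) (mem_vertex zv) vertex_of_eq yt zt.
by rewrite (porbit_morph i i_rot) imset_f.
Qed.

(** * The tetrahedron and its subdivision *)

(* The vertices of K4 are the elements of (Z/2)^2; the dart [(v, k)] goes from
   [v] to [v + dir k], where [dir] enumerates the nonzero vectors.  As
   these sum to 0, rotating [k] cyclically at every vertex gives four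
   triangular faces. *)
Definition K4_dart : finType := (bool * bool * option bool)%type.

Definition dir (k : option bool) : bool * bool :=
  match k with
  | None => (true, false)
  | Some false => (false, true)
  | Some true => (true, true)
  end.

Definition next_dir (k : option bool) : option bool :=
  match k with
  | None => Some false
  | Some false => Some true
  | Some true => None
  end.

Definition shift (v w : bool * bool) : bool * bool :=
  (v.1 (+) w.1, v.2 (+) w.2).

Definition K4_opp_fun (x : K4_dart) : K4_dart := (shift x.1 (dir x.2), x.2).
Definition K4_rot_fun (x : K4_dart) : K4_dart := (x.1, next_dir x.2).

Lemma K4_opp_funK : involutive K4_opp_fun.
Proof. by case=> [[[] []] [[]|]]. Qed.

Lemma K4_rot_fun_inj : injective K4_rot_fun.
Proof. by case=> [v [[]|]] [w [[]|]] // [->]. Qed.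

Lemma K4_oppK : involutive (perm (inv_inj K4_opp_funK)).
Proof. by move=> x; rewrite !permE K4_opp_funK. Qed.

Lemma K4_opp_neq x : perm (inv_inj K4_opp_funK) x != x.
Proof. by rewrite permE; case: x => [[[] []] [[]|]]. Qed.

Definition K4 : cmap := Cmap (perm K4_rot_fun_inj) K4_oppK K4_opp_neq.

Lemma K4_oppE : opp K4 =1 K4_opp_fun.
Proof. exact: permE. Qed.

Lemma K4_rotE : rot K4 =1 K4_rot_fun.
Proof. exact: permE. Qed.

(** The direction, with the value at the origin of the nonzero linear form that vanishes on this
    direction; both ends of the edge give the same value. *)
Definition K4_edge_label (x : K4_dart) : option bool * bool :=
  (x.2, match x.2 with
        | None => x.1.2
        | Some false => x.1.1
        | Some true => x.1.1 (+) x.1.2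
        end).

(** The origin of the only dart with direction [None] on the triangle of [x]. *)
Definition K4_face_label (x : K4_dart) : bool * bool :=
  match x.2 with
  | None => x.1
  | Some false => shift x.1 (dir None)
  | Some true => shift x.1 (dir (Some true))
  end.

Lemma K4_porbit_rot (x y : dart K4) : (y \in porbit (rot K4) x) = (x.1 == y.1).
Proof.
move: x y; apply: (porbit_label 3 K4_rotE) => //.
by do 2!case=> [[[] []] [[]|]].
Qed.

Lemma K4_porbit_opp (x y : dart K4) :
  (y \in porbit (opp K4) x) = (K4_edge_label x == K4_edge_label y).
Proof.
move: x y; apply: (porbit_label 2 K4_oppE).
  by case=> [[[] []] [[]|]].
by do 2!case=> [[[] []] [[]|]].
Qed.

Lemma K4_porbit_face (x y : dart K4) :
  (y \in porbit (face_perm K4) x) = (K4_face_label x == K4_face_label y).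
Proof.
have faceE : face_perm K4 =1 K4_rot_fun \o K4_opp_fun.
  by move=> z; rewrite permM K4_rotE K4_oppE.
move: x y; apply: (porbit_label 3 faceE).
  by case=> [[[] []] [[]|]].
by do 2!case=> [[[] []] [[]|]].
Qed.

Lemma K4_card_vertices : #|porbits (rot K4)| = 4.
Proof.
rewrite (@card_porbits_label _ _ _ fst (fun v => (v, None))) //.
  by rewrite card_prod card_bool.
exact: K4_porbit_rot.
Qed.

Lemma K4_connected (x y : dart K4) : connect (@dart_link K4) x y.
Proof.
have rotC z : connect (@dart_link K4) z (K4_rot_fun z).
  by apply/connect1/orP; left; rewrite K4_rotE.
have oppC z : connect (@dart_link K4) z (K4_opp_fun z).
  by apply/connect1/orP; right; rewrite K4_oppE.
(* At most two rotations lead from one direction to any other at the same vertex. *)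
have sameC v k l : connect (@dart_link K4) (v, k) (v, l).
  have := rotC (v, k); have := connect_trans (rotC (v, k)) (rotC _).
  by case: k => [[]|]; case: l => [[]|].
have dirC v k j l : connect (@dart_link K4) (v, k) (shift v (dir j), l).
  exact: connect_trans (sameC v k j) (connect_trans (oppC _) (sameC _ _ _)).
case: x y => [v k] [w l]; case: (v =P w) => [->//|vw].
have [j ->] : exists j, w = shift v (dir j); last exact: dirC.
case: v w vw => [[] []] [[] []] // _;
  by [exists None | exists (Some false) | exists (Some true)].
Qed.

(** Euler's formula reads 4 + 4 = 6 + 2. *)
Lemma K4_planar : planar K4.
Proof.
rewrite /planar K4_card_vertices.
rewrite (@card_porbits_label _ _ (opp K4) K4_edge_label
  (fun l : option bool * bool => match l.1 with
    | None => ((false, l.2), None)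
    | Some k => ((l.2, false), Some k)
    end)); [|by case=> [[[]|] []]|exact: K4_porbit_opp].
rewrite (@card_porbits_label _ _ _ K4_face_label (fun v => (v, None))) //;
  last exact: K4_porbit_face.
rewrite !card_prod card_option card_bool.
have symK4 : connect_sym (@dart_link K4) by move=> x y; rewrite !K4_connected.
have -> // : n_comp (@dart_link K4) predT = 1.
rewrite -(n_comp_connect symK4 (false, false, None)).
by apply: eq_n_comp_r => x; rewrite !inE K4_connected.
Qed.

Lemma K4_simple : simple_graph K4.
Proof.
split=> [x|x y]; rewrite !K4_porbit_rot !K4_oppE.
  by case: x => [[[] []] [[]|]].
by move: x y; do 2!case=> [[[] []] [[]|]].
Qed.

Lemma K4_adjacent (u v : vertex K4) : u != v -> adjacent u v.
Proof.
have [x ->] := vertex_ofP u; have [y ->] := vertex_ofP v.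
rewrite vertex_of_eq K4_porbit_rot => nxy.
have [k yk] : exists k, y.1 = shift x.1 (dir k).
  case: x y nxy => [[[] []] k] [[[] []] l] //= _;
    by [exists None | exists (Some false) | exists (Some true)].
have -> : vertex_of x = vertex_of ((x.1, k) : dart K4).
  by apply/eqP; rewrite vertex_of_eq K4_porbit_rot.
have -> : vertex_of y = vertex_of (opp K4 (x.1, k)); last exact: adjacent_vertex_of.
by apply/eqP; rewrite vertex_of_eq K4_porbit_rot K4_oppE yk.
Qed.

(** The graph is complete, so two distinct vertices outside [A] are already adjacent. *)
Lemma K4_3connected : k_connected 3 K4.
Proof.
split=> [|A _ u v uA vA]; first by rewrite card_vertex K4_card_vertices.
have [->|nuv] := eqVneq u v; first exact: connect0.
by apply: connect1; rewrite /= uA vA K4_adjacent.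
Qed.

(** * K4 with one edge subdivided *)

Definition K4_base : dart K4 := (false, false, None).

Definition K4_sub : cmap := @subdivide K4 K4_base.

Definition K4_sub_vertex_label (z : dart K4_sub) : option (bool * bool) :=
  if z is inl x then Some x.1 else None.

Lemma K4_sub_porbit_rot (z t : dart K4_sub) :
  (t \in porbit (rot K4_sub) z)
  = (K4_sub_vertex_label z == K4_sub_vertex_label t).
Proof.
pose f (z : dart K4_sub) : dart K4_sub :=
  match z with inl x => inl (K4_rot_fun x) | inr b => inr (~~ b) end.
have rotE : rot K4_sub =1 f by move=> [x|b]; rewrite permE //= K4_rotE.
move: z t; apply: (porbit_label 3 rotE); first by case.
by do 2!case=> [[[[] []] [[]|]]|[]].
Qed.

(** The label in K4 of the dart given by [unsubdivide]. *)
Definition K4_sub_face_label (z : dart K4_sub) : bool * bool :=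
  match z with
  | inl x => K4_face_label x
  | inr b => K4_face_label (if b then K4_opp_fun K4_base else K4_base)
  end.

Lemma K4_sub_porbit_face (z t : dart K4_sub) :
  (t \in porbit (face_perm K4_sub) z)
  = (K4_sub_face_label z == K4_sub_face_label t).
Proof.
pose f (z : dart K4_sub) : dart K4_sub :=
  match z with
  | inl x => if x == K4_base then inr false
             else if x == K4_opp_fun K4_base then inr true
             else inl (K4_rot_fun (K4_opp_fun x))
  | inr b => inl (K4_rot_fun (if b then K4_base else K4_opp_fun K4_base))
  end.
have faceE : face_perm K4_sub =1 f.
  move=> z'; rewrite permM !permE.
  case: z' => [x|[]] /=; rewrite ?K4_oppE ?K4_rotE //.
  by do 2!case: eqP => //= _; rewrite K4_rotE.
(* The two faces at the subdivided edge now have length 4. *)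
move: z t; apply: (porbit_label 4 faceE).
  by case=> [[[[] []] [[]|]]|[]].
by do 2!case=> [[[[] []] [[]|]]|[]].
Qed.

Lemma K4_sub_card_vertices : #|vertex K4_sub| = 5.
Proof.
rewrite card_vertex (@card_porbits_label _ _ _ K4_sub_vertex_label
  (fun l => if l is Some v then inl (v, None) else inr true)).
- by rewrite card_option card_prod card_bool.
- by case.
- exact: K4_sub_porbit_rot.
Qed.

Lemma K4_sub_cofacial (u v : vertex K4_sub) : @cofacial K4_sub u v.
Proof.
have [z ->] := vertex_ofP u; have [t ->] := vertex_ofP v.
(* All darts at the vertex labelled [l]; a case check finds, for any two vertices, darts with equal
   face labels. *)
pose reps (l : option (bool * bool)) : seq (dart K4_sub) :=
  if l is Some v then [:: inl (v, None); inl (v, Some false); inl (v, Some true)]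
  else [:: inr true; inr false].
have repsP w w' : w' \in reps (K4_sub_vertex_label w) ->
    vertex_of w = vertex_of w'.
  move=> ww; apply/eqP; rewrite vertex_of_eq K4_sub_porbit_rot.
  by move: w w' ww; do 2!case=> [[[[] []] [[]|]]|[]].
have /hasP[z' zz /hasP[t' tt ztf]] :
    has (fun z' => has (fun t' => K4_sub_face_label z' == K4_sub_face_label t')
           (reps (K4_sub_vertex_label t))) (reps (K4_sub_vertex_label z)).
  by case: z t => [[[[] []] ?]|?] [[[[] []] ?]|?].
rewrite (repsP _ _ zz) (repsP _ _ tt); apply: cofacial_vertex_of.
by rewrite K4_sub_porbit_face.
Qed.

(** The old vertices keep their degree 3, so the multigraph has a single edge. *)
Lemma K4_sub_vertex2 (v : vertex K4_sub) :
  degree v = 2 -> v = vertex_of (inr true : dart K4_sub).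
Proof.
have [[x|b] ->] := vertex_ofP v => [|_]; last first.
  by apply/eqP; rewrite vertex_of_eq K4_sub_porbit_rot.
rewrite /degree -[val _]/(porbit (rot K4_sub) (inl x)) porbit_sub_rot_inl.
rewrite card_imset; last by move=> ? ? [].
have -> : porbit (rot K4) x = [set (x.1, k) | k in {: option bool}].
  apply/setP => -[w k]; rewrite K4_porbit_rot.
  by apply/eqP/imsetP => [/= <-|[l _ [-> _]]]; first exists k.
by rewrite card_imset ?card_option ?card_bool // => ? ? [].
Qed.

Lemma K4_sub_chromatic_index :
  chromatic_index (subdivision_multigraph K4_sub) <= 1.
Proof.
apply/min_colors_le/colorableP; exists (fun=> ord0) => v w /eqP[].
apply: val_inj.
by rewrite (K4_sub_vertex2 _ (eqP (valP v))) (K4_sub_vertex2 _ (eqP (valP w))).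
Qed.

Theorem theorem6 :
  (forall R G : cmap,
     planar R -> simple_graph R -> k_connected 3 R -> subdivision R G ->
     cyclic_chromatic_number G
     <= chromatic_index (subdivision_multigraph G) + cyclic_chromatic_number R)
  /\
  (exists R G : cmap,
     [/\ planar R, simple_graph R, k_connected 3 R & subdivision R G] /\
     (exists v : vertex G, degree v = 2) /\
     cyclic_chromatic_number G
     = chromatic_index (subdivision_multigraph G) + cyclic_chromatic_number R).
Proof.
have bound R G : subdivision R G -> cyclic_chromatic_number G
    <= chromatic_index (subdivision_multigraph G) + cyclic_chromatic_number R.
  by case/subdivision_dart_embedding => i; apply: cyclic_chromatic_number_embedding.
split=> [R G _ _ _|]; first exact: bound.
have subK4 : subdivision K4 K4_sub := subdivision_subdivide K4 K4_base.
exists K4, K4_sub; split; [|split].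
- by split; [exact: K4_planar | exact: K4_simple | exact: K4_3connected |].
- by exists (vertex_of (inr true : dart K4_sub)); apply: card_porbit_sub_rot_inr.
apply/eqP; rewrite eqn_leq bound //=.
(* Five pairwise cofacial vertices need 5 colors, while the right-hand side is at most 1 + 4, as K4
   has 4 vertices. *)
apply: leq_trans (card_le_min_colors _ _ K4_sub_cofacial).
rewrite K4_sub_card_vertices -[5]/(1 + 4) leq_add ?K4_sub_chromatic_index //.
by rewrite -K4_card_vertices -card_vertex min_colors_le_card.
Qed.
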